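(* Let $\mathcal{V}$ be a distributive monoidal category, and let $\mathcal{A}$ and $\mathcal{B}$ be $\mathcal{V}$-enriched categories. An enriched lens $(F,\Phi):\mathcal{A}\rightleftharpoons\mathcal{B}$ is precisely a compatible square with top the enriched functor $F:\mathcal{A}\to\mathcal{B}$, left the enriched cofunctor $\Phi:\mathcal{A}\nrightarrow\mathcal{B}$, right the identity cofunctor $1_{\mathcal{B}}:\mathcal{B}\nrightarrow\mathcal{B}$, and bottom the identity functor $1_{\mathcal{B}}:\mathcal{B}\to\mathcal{B}$. That is, for every enriched functor $F:\mathcal{A}\to\mathcal{B}$ and every enriched cofunctor $\Phi:\mathcal{A}\nrightarrow\mathcal{B}$, the pair $(F,\Phi)$ is an enriched lens if and only if this square is a compatible square.
   Context: **Base.** $(\mathcal{V},\otimes,I)$ is a distributive monoidal category: a monoidal category with (set-indexed) coproducts, written $\sum$, such that $\otimes$ preserves coproducts in each variable. Coproduct injections are written $\iota_x$, copairings $[f_x]$, and $\cong$ denotes canonical isomorphisms. **Enriched categories and functors.** An enriched category $\mathcal{A}$ has a set $\mathrm{obj}(\mathcal{A})$, hom-objects $\mathcal{A}(x,y)\in\mathcal{V}$, identities $\eta_x:I\to\mathcal{A}(x,x)$ and composition $\mu_{x,y,z}:\mathcal{A}(x,y)\otimes\mathcal{A}(y,z)\to\mathcal{A}(x,z)$, satisfying the usual unit and associativity laws. An enriched functor $F:\mathcal{A}\to\mathcal{B}$ is a function on objects with morphisms $F_{a,a'}:\mathcal{A}(a,a')\to\mathcal{B}(Fa,Fa')$ preserving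 identities and composition. **Enriched cofunctors.** An enriched cofunctor $\Phi:\mathcal{A}\nrightarrow\mathcal{B}$ is a function $\Phi:\mathrm{obj}(\mathcal{A})\to\mathrm{obj}(\mathcal{B})$ together with lifting maps $\Phi_{a,b}:\mathcal{B}(\Phi a,b)\to\sum_{x\in\Phi^{-1}\{b\}}\mathcal{A}(a,x)$ in $\mathcal{V}$ such that: - (identities) $\Phi_{a,\Phi a}\circ\eta_{\Phi a}=\iota_a\circ\eta_a$; - (composites) with $X=\Phi^{-1}\{b\}$, $Y=\Phi^{-1}\{b'\}$, the morphism $\Phi_{a,b'}\circ\mu_{\Phi a,b,b'}:\mathcal{B}(\Phi a,b)\otimes\mathcal{B}(b,b')\to\sum_{y\in Y}\mathcal{A}(a,y)$ equals the composite $\mathcal{B}(\Phi a,b)\otimes\mathcal{B}(b,b')\xrightarrow{\Phi_{a,b}\otimes\mathrm{id}}\big(\sum_{x\in X}\mathcal{A}(a,x)\big)\otimes\mathcal{B}(b,b')\cong\sum_{x\in X}\mathcal{A}(a,x)\otimes\mathcal{B}(\Phi x,b')\xrightarrow{\sum\mathrm{id}\otimes\Phi_{x,b'}}\sum_{x\in X}\mathcal{A}(a,x)\otimes\big(\sum_{y\in Y}\mathcal{A}(x,y)\big)\cong\sum_{y\in Y}\sum_{x\in X}\mathcal{A}(a,x)\otimes\mathcal{A}(x,y)\xrightarrow{\sum[\mu_{a,x,y}]}\sum_{y\in Y}\mathcal{A}(a,y)$. The identity cofunctor $1_{\mathcal{B}}$ has identity object map and lifting maps the injections $\mathcal{B}(b,b')\to\sum_{x\in\{b'\}}\mathcal{B}(b,x)$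 (isomorphisms). **Enriched lens.** An enriched lens $(F,\Phi):\mathcal{A}\rightleftharpoons\mathcal{B}$ consists of an enriched functor $F:\mathcal{A}\to\mathcal{B}$ and an enriched cofunctor $\Phi:\mathcal{A}\nrightarrow\mathcal{B}$ such that $Fa=\Phi a$ for all $a\in\mathrm{obj}(\mathcal{A})$ and, for all $a\in\mathrm{obj}(\mathcal{A})$ and $b\in\mathrm{obj}(\mathcal{B})$, the composite $\mathcal{B}(Fa,b)\xrightarrow{\Phi_{a,b}}\sum_{x\in F^{-1}\{b\}}\mathcal{A}(a,x)\xrightarrow{[F_{a,x}]}\mathcal{B}(Fa,b)$ is the identity. **Compatible square.** A square with top an enriched functor $F:\mathcal{A}\to\mathcal{C}$, bottom an enriched functor $G:\mathcal{B}\to\mathcal{D}$, left an enriched cofunctor $\Phi:\mathcal{A}\nrightarrow\mathcal{B}$ and right an enriched cofunctor $\Psi:\mathcal{C}\nrightarrow\mathcal{D}$ is compatible if $G\Phi a=\Psi Fa$ for all $a\in\mathrm{obj}(\mathcal{A})$ and, for all $a\in\mathrm{obj}(\mathcal{A})$, $b\in\mathrm{obj}(\mathcal{B})$, with $X=\Phi^{-1}\{b\}$ and $Y=\Psi^{-1}\{Gb\}$, the composites $\mathcal{B}(\Phi a,b)\xrightarrow{G_{\Phi a,b}}\mathcal{D}(\Psi Fa,Gb)\xrightarrow{\Psi_{Fa,Gb}}\sum_{y\in Y}\mathcal{C}(Fa,y)$ and $\mathcal{B}(\Phi a,b)\xrightarrow{\Phi_{a,b}}\sum_{x\in X}\mathcal{A}(a,x)\xrightarrow{\sum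 F_{a,x}}\sum_{y\in Y}\mathcal{C}(Fa,y)$ are equal, where $\sum F_{a,x}$ is the copairing $[\iota_{Fx}\circ F_{a,x}]_{x\in X}$ (well defined as $\Psi Fx=G\Phi x=Gb$ for $x\in X$). *)

(* Defs.v *)
Set Implicit Arguments.
Unset Strict Implicit.
Unset Printing Implicit Defensive.

Declare Scope cat_scope.
Delimit Scope cat_scope with cat.
Local Open Scope cat_scope.

(* Sets are types, and all equations between morphisms are Leibniz equalities. *)
Record category := Category {
  ob :> Type;
  hom : ob -> ob -> Type;
  idm : forall X, hom X X;
  comp : forall X Y Z, hom Y Z -> hom X Y -> hom X Z;
  comp_idl : forall X Y (f : hom X Y), comp (idm Y) f = f;
  comp_idr : forall X Y (f : hom X Y), comp f (idm X) = f;
  comp_assoc : forall W X Y Z (h : hom Y Z) (g : hom X Y) (f : hom W X),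
    comp h (comp g f) = comp (comp h g) f
}.

Arguments hom {c} X Y.
Arguments idm {c} X.
Arguments comp {c X Y Z} g f.
Notation "g '∘' f" := (comp g f) (at level 40, left associativity) : cat_scope.

(* An inverse is unique when it exists, so this is the property of being
   invertible, kept in Type so that the inverse can be used as a morphism. *)
Record is_iso (C : category) (X Y : C) (f : hom X Y) := IsIso {
  inv : hom Y X;
  inv_compl : inv ∘ f = idm X;
  inv_compr : f ∘ inv = idm Y
}.

Arguments inv {C X Y f} i.

Record monoidal_category := MonoidalCategory {
  mcat :> category;
  tens : mcat -> mcat -> mcat;
  tensm : forall X X' Y Y' : mcat,
    hom X X' -> hom Y Y' -> hom (tens X Y) (tens X' Y');
  munit : mcat;
  tensm_id : forall X Y : mcat, tensm (idm X) (idm Y) = idm (tens X Y);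
  tensm_comp : forall (X X' X'' Y Y' Y'' : mcat) (f' : hom X' X'')
      (f : hom X X') (g' : hom Y' Y'') (g : hom Y Y'),
    tensm (f' ∘ f) (g' ∘ g) = tensm f' g' ∘ tensm f g;
  assoc : forall X Y Z : mcat, hom (tens (tens X Y) Z) (tens X (tens Y Z));
  unitl : forall X : mcat, hom (tens munit X) X;
  unitr : forall X : mcat, hom (tens X munit) X;
  assoc_iso : forall X Y Z, is_iso (assoc X Y Z);
  unitl_iso : forall X, is_iso (unitl X);
  unitr_iso : forall X, is_iso (unitr X);
  assoc_nat : forall (X X' Y Y' Z Z' : mcat) (f : hom X X') (g : hom Y Y')
      (h : hom Z Z'),
    assoc X' Y' Z' ∘ tensm (tensm f g) h = tensm f (tensm g h) ∘ assoc X Y Z;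
  unitl_nat : forall (X X' : mcat) (f : hom X X'),
    unitl X' ∘ tensm (idm munit) f = f ∘ unitl X;
  unitr_nat : forall (X X' : mcat) (f : hom X X'),
    unitr X' ∘ tensm f (idm munit) = f ∘ unitr X;
  triangle : forall X Y : mcat,
    tensm (idm X) (unitl Y) ∘ assoc X munit Y = tensm (unitr X) (idm Y);
  pentagon : forall W X Y Z : mcat,
    assoc W X (tens Y Z) ∘ assoc (tens W X) Y Z =
    tensm (idm W) (assoc X Y Z) ∘ assoc W (tens X Y) Z
      ∘ tensm (assoc W X Y) (idm Z)
}.

Arguments tensm {m X X' Y Y'} f g.
Arguments munit {m}.
Notation "X '⊗' Y" := (tens X Y) (at level 35, right associativity) : cat_scope.
Notation "f '⊗m' g" := (tensm f g) (at level 35, right associativity) : cat_scope.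

Record coproducts (C : category) := Coproducts {
  coprod_ob : forall I : Type, (I -> C) -> C;
  coprod_inj : forall (I : Type) (X : I -> C) (i : I), hom (X i) (coprod_ob X);
  coprod_copair : forall (I : Type) (X : I -> C) (Y : C),
    (forall i, hom (X i) Y) -> hom (coprod_ob X) Y;
  coprod_copairK : forall (I : Type) (X : I -> C) (Y : C)
      (f : forall i, hom (X i) Y) (i : I),
    coprod_copair f ∘ coprod_inj X i = f i;
  coprod_copair_uniq : forall (I : Type) (X : I -> C) (Y : C)
      (f : forall i, hom (X i) Y) (g : hom (coprod_ob X) Y),
    (forall i, g ∘ coprod_inj X i = f i) -> g = coprod_copair f
}.

(* The last two fields say that [_ ⊗ Y] and [Y ⊗ _] preserve coproducts: the
   canonical comparison maps are invertible. *)
Record distributive_monoidal_category := DistributiveMonoidalCategory {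
  dmcat :> monoidal_category;
  dmcoprod : coproducts dmcat;
  distl_iso : forall (I : Type) (X : I -> dmcat) (Y : dmcat),
    is_iso (coprod_copair dmcoprod (X := fun i => X i ⊗ Y)
              (fun i => coprod_inj dmcoprod X i ⊗m idm Y));
  distr_iso : forall (I : Type) (Y : dmcat) (X : I -> dmcat),
    is_iso (coprod_copair dmcoprod (X := fun i => Y ⊗ X i)
              (fun i => idm Y ⊗m coprod_inj dmcoprod X i))
}.

Section CoproductOperations.
Variable V : distributive_monoidal_category.

Definition coprod (I : Type) (X : I -> V) : V := coprod_ob (dmcoprod V) X.

Definition inj (I : Type) (X : I -> V) (i : I) : hom (X i) (coprod X) :=
  coprod_inj (dmcoprod V) X i.

Definition copair (I : Type) (X : I -> V) (Y : V) (f : forall i, hom (X i) Y) :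
  hom (coprod X) Y := coprod_copair (dmcoprod V) f.

Definition coprodm (I : Type) (X Y : I -> V) (f : forall i, hom (X i) (Y i)) :
  hom (coprod X) (coprod Y) := copair (fun i => inj Y i ∘ f i).

Definition distl (I : Type) (X : I -> V) (Y : V) :
  hom (coprod X ⊗ Y) (coprod (fun i => X i ⊗ Y)) := inv (distl_iso X Y).

Definition distr (I : Type) (Y : V) (X : I -> V) :
  hom (Y ⊗ coprod X) (coprod (fun i => Y ⊗ X i)) := inv (distr_iso Y X).

Definition coprod_swap (I J : Type) (X : I -> J -> V) :
  hom (coprod (fun i => coprod (fun j => X i j)))
      (coprod (fun j => coprod (fun i => X i j))) :=
  copair (fun i => copair (fun j =>
    inj (fun j => coprod (fun i => X i j)) j ∘ inj (fun i => X i j) i)).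

Lemma copair_inj (I : Type) (X : I -> V) (Y : V) (f : forall i, hom (X i) Y) i :
  copair f ∘ inj X i = f i.
Proof. exact (coprod_copairK (dmcoprod V) f i). Qed.

Lemma coprodm_inj (I : Type) (X Y : I -> V) (f : forall i, hom (X i) (Y i)) i :
  coprodm f ∘ inj X i = inj Y i ∘ f i.
Proof. apply copair_inj. Qed.

Lemma coprodm_inj_comp (I : Type) (X Y : I -> V)
    (f : forall i, hom (X i) (Y i)) i (Z : V) (k : hom Z (X i)) :
  coprodm f ∘ (inj X i ∘ k) = inj Y i ∘ (f i ∘ k).
Proof. now rewrite !comp_assoc, coprodm_inj. Qed.

Lemma distl_inj (I : Type) (X : I -> V) (Y : V) i :
  distl X Y ∘ (inj X i ⊗m idm Y) = inj (fun i => X i ⊗ Y) i.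
Proof.
pose proof (coprod_copairK (dmcoprod V)
  (fun i => coprod_inj (dmcoprod V) X i ⊗m idm Y) i) as H.
refine (eq_trans (f_equal (comp (inv (distl_iso X Y))) (eq_sym H)) _).
now rewrite comp_assoc, inv_compl, comp_idl.
Qed.

Lemma distr_inj (I : Type) (Y : V) (X : I -> V) i :
  distr Y X ∘ (idm Y ⊗m inj X i) = inj (fun i => Y ⊗ X i) i.
Proof.
pose proof (coprod_copairK (dmcoprod V)
  (fun i => idm Y ⊗m coprod_inj (dmcoprod V) X i) i) as H.
refine (eq_trans (f_equal (comp (inv (distr_iso Y X))) (eq_sym H)) _).
now rewrite comp_assoc, inv_compl, comp_idl.
Qed.

Lemma coprod_swap_inj (I J : Type) (X : I -> J -> V) i j :
  coprod_swap X ∘ inj (fun i => coprod (fun j => X i j)) i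
    ∘ inj (fun j => X i j) j =
  inj (fun j => coprod (fun i => X i j)) j ∘ inj (fun i => X i j) i.
Proof.
refine (eq_trans (f_equal (fun k => k ∘ inj (fun j => X i j) j)
  (copair_inj (X := fun i => coprod (fun j => X i j)) _ i)) _).
exact (copair_inj (X := fun j => X i j) _ j).
Qed.

End CoproductOperations.

Arguments coprodm_inj_comp {V I X Y} f i {Z} k.

Record enriched_category (V : distributive_monoidal_category) :=
  EnrichedCategory {
  eob :> Type;
  ehom : eob -> eob -> V;
  eid : forall x, hom munit (ehom x x);
  ecomp : forall x y z, hom (ehom x y ⊗ ehom y z) (ehom x z);
  ecomp_idl : forall x y,
    ecomp x x y ∘ (eid x ⊗m idm (ehom x y)) = unitl (ehom x y);
  ecomp_idr : forall x y,
    ecomp x y y ∘ (idm (ehom x y) ⊗m eid y) = unitr (ehom x y);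
  ecomp_assoc : forall w x y z,
    ecomp w y z ∘ (ecomp w x y ⊗m idm (ehom y z)) =
    ecomp w x z ∘ (idm (ehom w x) ⊗m ecomp x y z)
      ∘ assoc (ehom w x) (ehom x y) (ehom y z)
}.

Arguments ehom {V} A x y : rename.
Arguments eid {V} A x : rename.
Arguments ecomp {V} A x y z : rename.

(* The identity morphism between hom-objects whose endpoints are equal, but
   possibly not convertible. *)
Definition ehom_cast (V : distributive_monoidal_category)
    (A : enriched_category V) (x x' y y' : A) (p : x = x') (q : y = y') :
    hom (ehom A x y) (ehom A x' y') :=
  match p in _ = u, q in _ = v return hom (ehom A x y) (ehom A u v) with
  | eq_refl, eq_refl => idm (ehom A x y)
  end.

Record enriched_functor (V : distributive_monoidal_category)
    (A B : enriched_category V) := EnrichedFunctor {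
  fob :> A -> B;
  fhom : forall a a', hom (ehom A a a') (ehom B (fob a) (fob a'));
  fhom_id : forall a, fhom a a ∘ eid A a = eid B (fob a);
  fhom_comp : forall a a' a'',
    fhom a a'' ∘ ecomp A a a' a'' =
    ecomp B (fob a) (fob a') (fob a'') ∘ (fhom a a' ⊗m fhom a' a'')
}.

Arguments fhom {V A B} F a a' : rename.

Record fiber (V : distributive_monoidal_category)
    (A B : enriched_category V) (f : A -> B) (b : B) := Fiber {
  fiber_pt :> A;
  fiber_eq : f fiber_pt = b
}.

Arguments Fiber {V A B} f b fiber_pt fiber_eq.
Arguments fiber_eq {V A B f b} x : rename.

Definition fiber_self (V : distributive_monoidal_category)
    (A B : enriched_category V) (f : A -> B) (a : A) : fiber f (f a) :=
  Fiber f (f a) a eq_refl.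

(* In [lift_comp], [ehom_cast] realises B(b, b') = B(Phi x, b') for x in the
   fibre over b, and [coprod_swap] after [distr] is the canonical isomorphism
   moving the coproduct over the fibre of b' to the outside. *)
Record enriched_cofunctor (V : distributive_monoidal_category)
    (A B : enriched_category V) := EnrichedCofunctor {
  cob :> A -> B;
  lift : forall (a : A) (b : B),
    hom (ehom B (cob a) b) (coprod (fun x : fiber cob b => ehom A a x));
  lift_id : forall a : A,
    lift a (cob a) ∘ eid B (cob a) =
    inj (fun x : fiber cob (cob a) => ehom A a x) (fiber_self cob a)
      ∘ eid A a;
  lift_comp : forall (a : A) (b b' : B),
    lift a b' ∘ ecomp B (cob a) b b' =
    coprodm (fun y : fiber cob b' =>
        copair (fun x : fiber cob b => ecomp A a x y))
      ∘ coprod_swap (fun (x : fiber cob b) (y : fiber cob b') =>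
          ehom A a x ⊗ ehom A x y)
      ∘ coprodm (fun x : fiber cob b =>
          distr (ehom A a x) (fun y : fiber cob b' => ehom A x y))
      ∘ coprodm (fun x : fiber cob b => idm (ehom A a x) ⊗m lift x b')
      ∘ coprodm (fun x : fiber cob b =>
          idm (ehom A a x) ⊗m ehom_cast (eq_sym (fiber_eq x)) (eq_refl b'))
      ∘ distl (fun x : fiber cob b => ehom A a x) (ehom B b b')
      ∘ (lift a b ⊗m idm (ehom B b b'))
}.

Arguments lift {V A B} Phi a b : rename.

Section Identities.
Variables (V : distributive_monoidal_category) (B : enriched_category V).

Definition id_functor : enriched_functor B B.
Proof.
refine (@EnrichedFunctor V B B (fun b => b) (fun b b' => idm (ehom B b b')) _ _).
- intros a. apply comp_idl.
- intros a a' a''. now rewrite tensm_id, comp_idl, comp_idr.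
Defined.

Definition id_cofunctor_lift (b b' : B) :
    hom (ehom B b b')
        (coprod (fun x : fiber (fun c : B => c) b' => ehom B b x)) :=
  inj (fun x : fiber (fun c : B => c) b' => ehom B b x)
    (fiber_self (fun c : B => c) b').

Lemma id_cofunctor_lift_comp (a b b' : B) (f := fun c : B => c) :
  id_cofunctor_lift a b' ∘ ecomp B a b b' =
  coprodm (fun y : fiber f b' => copair (fun x : fiber f b => ecomp B a x y))
    ∘ coprod_swap (fun (x : fiber f b) (y : fiber f b') =>
        ehom B a x ⊗ ehom B x y)
    ∘ coprodm (fun x : fiber f b =>
        distr (ehom B a x) (fun y : fiber f b' => ehom B x y))
    ∘ coprodm (fun x : fiber f b =>
        idm (ehom B a x) ⊗m id_cofunctor_lift x b')
    ∘ coprodm (fun x : fiber f b =>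
        idm (ehom B a x) ⊗m ehom_cast (eq_sym (fiber_eq x)) (eq_refl b'))
    ∘ distl (fun x : fiber f b => ehom B a x) (ehom B b b')
    ∘ (id_cofunctor_lift a b ⊗m idm (ehom B b b')).
Proof.
set (sb := fiber_self f b); set (sb' := fiber_self f b').
rewrite <- !comp_assoc; symmetry.
etransitivity.
  do 5 apply (f_equal (comp _)).
  exact (distl_inj (fun x : fiber f b => ehom B a x) (ehom B b b') sb).
etransitivity.
  do 4 apply (f_equal (comp _)).
  exact (coprodm_inj (fun x : fiber f b =>
    idm (ehom B a x) ⊗m ehom_cast (eq_sym (fiber_eq x)) (eq_refl b')) sb).
etransitivity.
  do 3 apply (f_equal (comp _)).
  exact (coprodm_inj_comp (fun x : fiber f b =>
    idm (ehom B a x) ⊗m id_cofunctor_lift x b') sb _).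
etransitivity.
  do 2 apply (f_equal (comp _)).
  exact (coprodm_inj_comp (fun x : fiber f b =>
    distr (ehom B a x) (fun y : fiber f b' => ehom B x y)) sb _).
etransitivity.
  do 4 apply (f_equal (comp _)).
  exact (eq_trans (f_equal (comp _) (tensm_id _ _)) (comp_idr _)).
etransitivity.
  do 3 apply (f_equal (comp _)).
  exact (distr_inj (ehom B a sb) (fun y : fiber f b' => ehom B sb y) sb').
etransitivity.
  apply (f_equal (comp _)).
  exact (eq_trans (comp_assoc _ _ _) (coprod_swap_inj
    (fun (x : fiber f b) (y : fiber f b') => ehom B a x ⊗ ehom B x y) sb sb')).
etransitivity.
  exact (coprodm_inj_comp (fun y : fiber f b' =>
    copair (fun x : fiber f b => ecomp B a x y)) sb' _).
apply (f_equal (comp _)).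
exact (copair_inj (fun x : fiber f b => ecomp B a x sb') sb).
Qed.

Definition id_cofunctor : enriched_cofunctor B B :=
  @EnrichedCofunctor V B B (fun b => b) id_cofunctor_lift
    (fun a => eq_refl) id_cofunctor_lift_comp.

End Identities.

(* In the two definitions below the existential quantifier is a dependent
   conjunction: the condition on morphisms only typechecks given the agreement
   on objects.  As [F] and [Phi] agree on objects, the fibre of [F] over [b] is
   written as that of [Phi]. *)
Definition is_enriched_lens (V : distributive_monoidal_category)
    (A B : enriched_category V) (F : enriched_functor A B)
    (Phi : enriched_cofunctor A B) : Prop :=
  exists E : forall a : A, F a = Phi a,
  forall (a : A) (b : B),
    copair (fun x : fiber Phi b =>
        ehom_cast (eq_refl (F a)) (eq_trans (E x) (fiber_eq x)) ∘ fhom F a x)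
      ∘ lift Phi a b
      ∘ ehom_cast (E a) (eq_refl b)
    = idm (ehom B (F a) b).

Definition is_compatible_square (V : distributive_monoidal_category)
    (A B C D : enriched_category V)
    (F : enriched_functor A C) (G : enriched_functor B D)
    (Phi : enriched_cofunctor A B) (Psi : enriched_cofunctor C D) : Prop :=
  exists E : forall a : A, G (Phi a) = Psi (F a),
  forall (a : A) (b : B),
    lift Psi (F a) (G b)
      ∘ ehom_cast (E a) (eq_refl (G b))
      ∘ fhom G (Phi a) b
    = copair (fun x : fiber Phi b =>
        inj (fun y : fiber Psi (G b) => ehom C (F a) y)
            (Fiber Psi (G b) (F x)
               (eq_trans (eq_sym (E x)) (f_equal G (fiber_eq x))))
          ∘ fhom F a x)
      ∘ lift Phi a b.

(* Main.v *)
(* Every element y of the fibre of the identity over b is equal to b, so the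
   lifting map of the identity cofunctor is a split monomorphism, and the
   injection at y is this map precomposed with the identification of B(a, y)
   with B(a, b).  Hence both sides of the square condition factor through this
   monomorphism; cancelling it leaves the lens condition. *)
From Stdlib Require Import Setoid.
Require Import Defs.

Set Implicit Arguments.
Unset Strict Implicit.
Unset Printing Implicit Defensive.
Local Open Scope cat_scope.

Lemma copair_ext (V : distributive_monoidal_category) (I : Type) (X : I -> V)
    (Y : V) (f g : forall i, hom (X i) Y) :
  (forall i, f i = g i) -> copair f = copair g.
Proof.
intros fg; apply (coprod_copair_uniq (c := dmcoprod V)); intros i.
rewrite <- fg; apply copair_inj.
Qed.

Lemma comp_copair (V : distributive_monoidal_category) (I : Type) (X : I -> V)
    (Y Z : V) (h : hom Y Z) (f : forall i, hom (X i) Y) :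
  h ∘ copair f = copair (fun i => h ∘ f i).
Proof.
apply (coprod_copair_uniq (c := dmcoprod V)); intros i.
rewrite <- comp_assoc; apply f_equal, copair_inj.
Qed.

Section Casts.
Variables (V : distributive_monoidal_category) (B : enriched_category V).

(** A cast is invertible, with inverse the cast along the reversed equalities. This moves the cast
    in the lens condition to the other side, where the cancelled square condition has it. *)
Lemma comp_ehom_cast_eq_id (x x' y y' : B) (p : x = x') (q : y = y')
    (g : hom (ehom B x' y') (ehom B x y)) :
  g ∘ ehom_cast p q = idm (ehom B x y) <->
  ehom_cast (eq_sym p) (eq_sym q) = g.
Proof.
destruct p, q; simpl; rewrite comp_idr; split; intros e; now symmetry.
Qed.

Lemma inj_id_fiber (a b : B) (y : fiber (fun c : B => c) b) :
  inj (fun x : fiber (fun c : B => c) b => ehom B a x) y =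
  id_cofunctor_lift a b ∘ ehom_cast (eq_refl a) (fiber_eq y).
Proof.
destruct y as [c e]; destruct e; symmetry; apply comp_idr.
Qed.

Lemma id_cofunctor_lift_mono (a b : B) (Z : V) (f g : hom Z (ehom B a b)) :
  id_cofunctor_lift a b ∘ f = id_cofunctor_lift a b ∘ g <-> f = g.
Proof.
split; [intros fg | now intros ->].
(* The retraction glues the identifications of the [ehom B a y] with [ehom B a b]; at [fiber_self]
   the cast computes to the identity. *)
pose (r := copair (fun y : fiber (fun c : B => c) b =>
  ehom_cast (eq_refl a) (fiber_eq y))).
assert (rK : r ∘ id_cofunctor_lift a b = idm _).
  exact (copair_inj (fun y : fiber (fun c : B => c) b =>
    ehom_cast (eq_refl a) (fiber_eq y)) (fiber_self _ b)).
now rewrite <- (comp_idl f), <- (comp_idl g), <- rK, <- !comp_assoc, fg.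
Qed.

End Casts.

(** The proof [E] is arbitrary, so that both directions of the theorem can use this cancellation. *)
Lemma id_square_condition (V : distributive_monoidal_category)
    (A B : enriched_category V) (F : enriched_functor A B)
    (Phi : enriched_cofunctor A B)
    (E : forall a, id_functor B (Phi a) = id_cofunctor B (F a)) (a : A)
    (b : B) :
  lift (id_cofunctor B) (F a) (id_functor B b)
      ∘ ehom_cast (E a) (eq_refl (id_functor B b))
      ∘ fhom (id_functor B) (Phi a) b
    = copair (fun x : fiber Phi b =>
        inj (fun y : fiber (id_cofunctor B) (id_functor B b) => ehom B (F a) y)
            (Fiber (id_cofunctor B) (id_functor B b) (F x)
               (eq_trans (eq_sym (E x)) (f_equal (id_functor B) (fiber_eq x))))
          ∘ fhom F a x)
      ∘ lift Phi a b <->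
  ehom_cast (E a) (eq_refl b) =
  copair (fun x : fiber Phi b =>
      ehom_cast (eq_refl (F a)) (eq_trans (eq_sym (E x)) (fiber_eq x))
        ∘ fhom F a x)
    ∘ lift Phi a b.
Proof.
rewrite <- id_cofunctor_lift_mono, (comp_assoc (id_cofunctor_lift _ _)),
  comp_copair.
rewrite (copair_ext (g := fun x : fiber Phi b => id_cofunctor_lift (F a) b ∘
  (ehom_cast (eq_refl (F a)) (eq_trans (eq_sym (E x)) (fiber_eq x))
    ∘ fhom F a x))).
- now simpl; rewrite comp_idr.
(* Once [b] is [Phi c], the [f_equal] computes away and both sides carry the same fibre element. *)
- intros [c e]; destruct e; rewrite comp_assoc.
  apply (f_equal (fun k => k ∘ fhom F a c)).
  exact (inj_id_fiber (F a) (Fiber (fun d : B => d) (Phi c) (F c)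
    (eq_trans (eq_sym (E c)) eq_refl))).
Qed.

Theorem proposition10 (V : distributive_monoidal_category)
    (A B : enriched_category V)
    (F : enriched_functor A B) (Phi : enriched_cofunctor A B) :
  is_enriched_lens F Phi <->
  is_compatible_square F (id_functor B) Phi (id_cofunctor B).
Proof.
split; intros [E H].
- exists (fun a => eq_sym (E a)); intros a b.
  apply (id_square_condition (F := F) (Phi := Phi) (fun a => eq_sym (E a))).
  specialize (H a b); apply comp_ehom_cast_eq_id in H.
  refine (eq_trans H (f_equal (fun k => k ∘ lift Phi a b) _)).
  (* Lens and square state the agreement on objects in opposite directions, so [E x] comes back
     reversed twice, here under the binder of the copairing. *)
  now apply copair_ext; intros x; rewrite eq_sym_involutive.
- exists (fun a => eq_sym (E a)); intros a b.
  apply comp_ehom_cast_eq_id; simpl; rewrite eq_sym_involutive.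
  exact (proj1 (id_square_condition E a b) (H a b)).
Qed.
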